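(* (a) The set $\mathbf{Diff}_1$ is a subgroup of the group $\overline{\mathbf{Diff}}$ of formal diffeomorphisms of the line. (b) Identify $\mathbf{Diff}_1$ with the Banach space $W_1$ via $x+\sum_{j\ge 2}a_jx^j\leftrightarrow (a_2,a_3,\dots)$. Then the multiplication (composition) in $\mathbf{Diff}_1$ induces an analytic map $W_1\times W_1\to W_1$, and the inversion $\gamma\mapsto\gamma^{-1}$ induces an analytic map $W_1\to W_1$.
   Context: $\overline{\mathbf{Diff}}$ is the group of all formal power series $\gamma(x)=x+\sum_{j\ge 2}a_jx^j$ with $a_j\in\mathbb{R}$, with group operation the substitution of formal series, $(\gamma_1\circ\gamma_2)(x)=\gamma_1(\gamma_2(x))$. $W_1$ is the real Banach space of real sequences $a=(a_2,a_3,\dots)$ with $\|a\|:=\sum_{j\ge 2}\frac{|a_j|}{j!}<\infty$. $\mathbf{Diff}_1\subset\overline{\mathbf{Diff}}$ is the set of all $\gamma(x)=x+\sum_{j\ge2}a_jx^j$ such that $(a_2,a_3,\dots)\in W_1$. ''Analytic'' means real analytic as a map between real Banach spaces. *)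

(* Defs.v *)
From HB Require Import structures.
From mathcomp Require Import all_boot all_order all_algebra.
From mathcomp Require Import all_classical all_reals all_analysis.
From mathcomp Require Import zify.

Set Implicit Arguments.
Unset Strict Implicit.
Unset Printing Implicit Defensive.

Import Order.TTheory GRing.Theory Num.Theory.
Import numFieldNormedType.Exports.

Local Open Scope classical_set_scope.
Local Open Scope ring_scope.

(* A formal series [\sum_n f_n x^n] is represented by [f : nat -> R]. *)

Section Substitution.
Variable R : realType.
Implicit Types (p q : {poly R}) (f g h : nat -> R).

(* The coefficient of x^n in \sum_k f_k g(x)^k.  When g_0 = 0, the power g^k
   starts at x^k, so only the terms k <= n contribute and only the
   coefficients g_0, ..., g_n matter. *)
Definition fs_subst f g : nat -> R :=
  fun n => \sum_(k < n.+1) f k * ((\poly_(i < n.+1) g i) ^+ k)`_n.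

Definition fs_id : nat -> R := fun n => (n == 1%N)%:R.

Definition eqmodX N p q := forall i, (i < N)%N -> p`_i = q`_i.

Lemma eqmodX_mul N p p' q q' :
  eqmodX N p p' -> eqmodX N q q' -> eqmodX N (p * q) (p' * q').
Proof.
move=> pp' qq' i iN; rewrite !coefM; apply: eq_bigr => j _.
rewrite pp' ?qq' //; first exact: leq_ltn_trans (leq_subr _ _) iN.
by apply: leq_ltn_trans iN; rewrite -ltnS.
Qed.

Lemma eqmodX_exp N p p' k : eqmodX N p p' -> eqmodX N (p ^+ k) (p' ^+ k).
Proof.
move=> pp'; elim: k => [|k IH]; first by rewrite !expr0.
by rewrite !exprS; exact: eqmodX_mul.
Qed.

Lemma coef_exp_lt q k n : q`_0 = 0 -> (n < k)%N -> (q ^+ k)`_n = 0.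
Proof.
move=> q0; elim: k n => // k IH n nk.
rewrite exprS coefM big1 // => -[[|j] jn] _ /=; first by rewrite q0 mul0r.
rewrite IH ?mulr0 //; lia.
Qed.

Lemma coef_exp_diag q k : q`_0 = 0 -> q`_1 = 1 -> (q ^+ k)`_k = 1.
Proof.
move=> q0 q1; elim: k => [|k IH]; first by rewrite expr0 coef1.
rewrite exprS coefM big_ord_recl q0 mul0r add0r big_ord_recl /= /bump /=.
rewrite add1n subSS subn0 q1 IH mul1r big1 ?addr0 // => i _.
by rewrite coef_exp_lt ?mulr0 // /bump /=; have := ltn_ord i; lia.
Qed.

Lemma coef_comp_trunc p q N n : q`_0 = 0 -> (n < N)%N ->
  (p \Po q)`_n = \sum_(k < N) p`_k * (q ^+ k)`_n.
Proof.
move=> q0 nN; rewrite comp_polyE coef_sum.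
under eq_bigr do rewrite coefZ.
rewrite -!(big_mkord xpredT (fun k => p`_k * (q ^+ k)`_n)).
have sm a b : (a <= b)%N ->
    (forall k, (a <= k)%N -> p`_k * (q ^+ k)`_n = 0) ->
    \sum_(0 <= k < b) p`_k * (q ^+ k)`_n = \sum_(0 <= k < a) p`_k * (q ^+ k)`_n.
  move=> ab H; rewrite (big_cat_nat (n := a)) //= [X in _ + X]big_nat_cond.
  by rewrite [X in _ + X]big1 ?addr0 // => k /andP[/andP[/H]].
case: (leqP (size p) N) => sN.
  by rewrite [RHS](sm (size p)) // => k pk; rewrite nth_default // mul0r.
apply: sm; first exact: ltnW.
by move=> k Nk; rewrite coef_exp_lt ?mulr0 //; apply: leq_trans Nk.
Qed.

Lemma fs_substE f g N n : g 0 = 0 -> (n < N)%N ->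
  fs_subst f g n = ((\poly_(i < N) f i) \Po (\poly_(i < N) g i))`_n.
Proof.
move=> g0 nN; have tg0 m : (\poly_(i < m) g i)`_0 = 0.
  by rewrite coef_poly; case: ifP.
rewrite (@coef_comp_trunc _ _ n.+1) //; apply: eq_bigr => k _.
rewrite coef_poly (leq_trans (ltn_ord k) nN); congr (_ * _).
apply: (@eqmodX_exp n.+1) => // i iN; rewrite !coef_poly iN.
by rewrite (leq_trans iN nN).
Qed.

Lemma fs_subst0 f g : f 0 = 0 -> fs_subst f g 0 = 0.
Proof. by move=> f0; rewrite /fs_subst big_ord1 f0 mul0r. Qed.

Lemma fs_subst1 f g : f 0 = 0 -> f 1 = 1 -> g 1 = 1 -> fs_subst f g 1 = 1.
Proof.
move=> f0 f1 g1; rewrite /fs_subst big_ord_recl f0 mul0r add0r big_ord1 /=.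
by rewrite f1 expr1 mul1r coef_poly g1.
Qed.

Lemma fs_substA f g h : g 0 = 0 -> h 0 = 0 ->
  fs_subst f (fs_subst g h) = fs_subst (fs_subst f g) h.
Proof.
move=> g0 h0; apply/funext => n.
have gh0 := fs_subst0 h g0.
have z u m : u 0 = 0 -> (\poly_(i < m) u i)`_0 = 0 :> R.
  by move=> u0; rewrite coef_poly; case: ifP.
rewrite [LHS](@fs_substE _ _ n.+1) // [RHS](@fs_substE _ _ n.+1) //.
set N := n.+1.
have E1 : eqmodX N (\poly_(i < N) fs_subst g h i)
    ((\poly_(i < N) g i) \Po (\poly_(i < N) h i)).
  by move=> i iN; rewrite coef_poly iN (fs_substE _ _ iN).
have E2 : eqmodX N (\poly_(i < N) fs_subst f g i)
    ((\poly_(i < N) f i) \Po (\poly_(i < N) g i)).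
  by move=> i iN; rewrite coef_poly iN (fs_substE _ _ iN).
transitivity
  ((\poly_(i < N) f i \Po (\poly_(i < N) g i \Po \poly_(i < N) h i))`_n).
  have zc : (\poly_(i < N) g i \Po \poly_(i < N) h i)`_0 = 0.
    by rewrite -E1 // z.
  rewrite [LHS](@coef_comp_trunc _ _ N) ?z //.
  rewrite [RHS](@coef_comp_trunc _ _ N) //.
  by apply: eq_bigr => k _; congr (_ * _); apply: (@eqmodX_exp N).
rewrite comp_polyA [LHS](@coef_comp_trunc _ _ N) ?z //.
rewrite [RHS](@coef_comp_trunc _ _ N) ?z //.
by apply: eq_bigr => k _; rewrite E2.
Qed.

Lemma fs_substx1 f : fs_subst f fs_id = f.
Proof.
apply/funext => n; rewrite (@fs_substE _ _ n.+2) //.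
have -> : \poly_(i < n.+2) fs_id i = 'X :> {poly R}.
  apply/polyP => i; rewrite coef_poly coefX /fs_id.
  by case: ltnP => // ni; case: eqP => // i1; move: ni; rewrite i1.
by rewrite comp_polyXr coef_poly ltnW.
Qed.

Lemma fs_subst1x f : f 0 = 0 -> fs_subst fs_id f = f.
Proof.
move=> f0; apply/funext => n; rewrite (@fs_substE _ _ n.+2) //.
have -> : \poly_(i < n.+2) fs_id i = 'X :> {poly R}.
  apply/polyP => i; rewrite coef_poly coefX /fs_id.
  by case: ltnP => // ni; case: eqP => // i1; move: ni; rewrite i1.
by rewrite comp_polyX coef_poly ltnW.
Qed.

(* The coefficients h_0, ..., h_{n-1} of the series h with h(f(x)) = x. *)
Fixpoint fs_inv_seq f n : seq R :=
  if n is m.+1 then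
    let s := fs_inv_seq f m in
    rcons s (fs_id m -
      \sum_(k < m) s`_k * ((\poly_(i < m.+1) f i) ^+ k)`_m)
  else [::].

Definition fs_inv f : nat -> R := fun n => (fs_inv_seq f n.+1)`_n.

Lemma size_fs_inv_seq f n : size (fs_inv_seq f n) = n.
Proof. by elim: n => //= n IH; rewrite size_rcons IH. Qed.

Lemma nth_fs_inv_seq f n k : (k < n)%N -> (fs_inv_seq f n)`_k = fs_inv f k.
Proof.
elim: n => // n IH; rewrite ltnS leq_eqVlt => /orP[/eqP -> //|kn].
by rewrite /= nth_rcons size_fs_inv_seq kn IH.
Qed.

Lemma fs_invE f n : fs_inv f n =
  fs_id n - \sum_(k < n) fs_inv f k * ((\poly_(i < n.+1) f i) ^+ k)`_n.
Proof.
rewrite {1}/fs_inv /= nth_rcons size_fs_inv_seq ltnn eqxx; congr (_ - _).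
by apply: eq_bigr => k _; rewrite nth_fs_inv_seq.
Qed.

Lemma fs_inv0 f : fs_inv f 0 = 0.
Proof. by rewrite fs_invE big_ord0 subr0. Qed.

Lemma fs_inv1 f : fs_inv f 1 = 1.
Proof. by rewrite fs_invE big_ord1 fs_inv0 mul0r subr0. Qed.

Lemma fs_subst_invl f : f 0 = 0 -> f 1 = 1 ->
  fs_subst (fs_inv f) f = fs_id.
Proof.
move=> f0 f1; apply/funext => n; rewrite /fs_subst big_ord_recr /=.
case: n => [|n].
  by rewrite big_ord0 fs_inv0 mul0r addr0.
rewrite coef_exp_diag ?coef_poly //= ?f0 ?f1 // mulr1 [fs_inv f n.+1]fs_invE.
by rewrite addrC subrK.
Qed.

End Substitution.
Arguments fs_id {R}.

Section FormalDiffeo.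
Variable R : realType.

Record Diffbar := MkDiffbar {
  dcoef :> nat -> R ;
  _ : (dcoef 0 == 0) && (dcoef 1 == 1) }.

HB.instance Definition _ := [isSub for dcoef].
HB.instance Definition _ := [Choice of Diffbar by <:].

Implicit Types a b c : Diffbar.

Lemma dcoef0 a : a 0%N = 0. Proof. by case/andP: (valP a) => /eqP. Qed.
Lemma dcoef1 a : a 1%N = 1. Proof. by case/andP: (valP a) => _ /eqP. Qed.

Lemma Diffbar_one_subproof : ((fs_id 0 : R) == 0) && ((fs_id 1 : R) == 1).
Proof. by rewrite /fs_id /= !eqxx. Qed.

Lemma Diffbar_mul_subproof a b :
  (fs_subst a b 0 == 0) && (fs_subst a b 1 == 1).
Proof. by rewrite fs_subst0 ?fs_subst1 ?dcoef0 ?dcoef1 ?eqxx. Qed.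

Lemma Diffbar_inv_subproof a : (fs_inv a 0 == 0) && (fs_inv a 1 == 1).
Proof. by rewrite fs_inv0 fs_inv1 !eqxx. Qed.

Definition Diffbar_one : Diffbar := MkDiffbar Diffbar_one_subproof.
Definition Diffbar_mul a b : Diffbar := MkDiffbar (Diffbar_mul_subproof a b).
Definition Diffbar_inv a : Diffbar := MkDiffbar (Diffbar_inv_subproof a).

Lemma Diffbar_mulA : associative Diffbar_mul.
Proof. by move=> a b c; apply/val_inj; rewrite /= fs_substA ?dcoef0. Qed.

Lemma Diffbar_mul1g : left_id Diffbar_one Diffbar_mul.
Proof. by move=> a; apply/val_inj; rewrite /= fs_subst1x ?dcoef0. Qed.

Lemma Diffbar_mulg1 : right_id Diffbar_one Diffbar_mul.
Proof. by move=> a; apply/val_inj; rewrite /= fs_substx1. Qed.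

Lemma Diffbar_mulVg : left_inverse Diffbar_one Diffbar_inv Diffbar_mul.
Proof.
by move=> a; apply/val_inj; rewrite /= fs_subst_invl ?dcoef0 ?dcoef1.
Qed.

Lemma Diffbar_mulgV : right_inverse Diffbar_one Diffbar_inv Diffbar_mul.
Proof.
move=> a; set b := Diffbar_inv a.
rewrite -(Diffbar_mul1g (Diffbar_mul a b)) -{1}(Diffbar_mulVg b).
rewrite -Diffbar_mulA (Diffbar_mulA b) {2}/b Diffbar_mulVg Diffbar_mul1g.
exact: Diffbar_mulVg.
Qed.

HB.instance Definition _ := isGroup.Build Diffbar Diffbar_mulA
  Diffbar_mul1g Diffbar_mulg1 Diffbar_mulVg Diffbar_mulgV.

End FormalDiffeo.

(* In this section a sequence (a_2, a_3, ...) is represented by [u : nat -> R]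
   with [u n] standing for a_{n+2}. *)

Section W1.
Variable R : realType.
Implicit Types u v : nat -> R.

Definition W1_term u : nat -> R := fun n => `|u n| / (n.+2)`!%:R.

Definition W1_pred : {pred nat -> R} := mem [set u | cvgn (series (W1_term u))].

Lemma W1_term_ge0 u n : 0 <= W1_term u n.
Proof. by rewrite /W1_term divr_ge0. Qed.

Lemma W1_termD u v n : W1_term (u + v) n <= W1_term u n + W1_term v n.
Proof. by rewrite /W1_term -mulrDl ler_wpM2r ?invr_ge0 // ler_normD. Qed.

Lemma W1_termZ k u : W1_term (k *: u) = `|k| *: W1_term u.
Proof. by apply/funext => n; rewrite /W1_term normrM -mulrA. Qed.

Lemma W1_predP u : reflect (cvgn (series (W1_term u))) (u \in W1_pred).
Proof. by apply: (iffP idP) => [/set_mem|/mem_set]. Qed.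

Lemma W1_predD u v : u \in W1_pred -> v \in W1_pred -> u + v \in W1_pred.
Proof.
move=> /W1_predP cu /W1_predP cv; apply/W1_predP.
apply: (@series_le_cvg _ _ (W1_term u + W1_term v)).
- exact: W1_term_ge0.
- by move=> n; rewrite addr_ge0 ?W1_term_ge0.
- exact: W1_termD.
- exact: is_cvg_seriesD.
Qed.

Lemma W1_predZ k u : u \in W1_pred -> k *: u \in W1_pred.
Proof.
by move=> /W1_predP cu; apply/W1_predP; rewrite W1_termZ; exact: is_cvg_seriesZ.
Qed.

Lemma W1_submod_closed : submod_closed W1_pred.
Proof.
split=> [|k u v cu cv]; last by apply: W1_predD => //; exact: W1_predZ.
apply/W1_predP.
have -> : W1_term 0 = 0 by apply/funext => n; rewrite /W1_term normr0 mul0r.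
rewrite (_ : series 0 = cst 0); first exact: is_cvg_cst.
by apply/funext => n; rewrite /series /= big1.
Qed.

HB.instance Definition _ :=
  GRing.isSubmodClosed.Build _ _ W1_pred W1_submod_closed.

Record W1 := MkW1 { W1_seq :> nat -> R ; _ : W1_seq \in W1_pred }.

HB.instance Definition _ := [isSub for W1_seq].
HB.instance Definition _ := [Choice of W1 by <:].
HB.instance Definition _ := [SubChoice_isSubLmodule of W1 by <:].

Implicit Types a b : W1.

Definition W1_norm a : R := limn (series (W1_term a)).

Lemma W1_cvg a : cvgn (series (W1_term a)).
Proof. exact/W1_predP/(valP a). Qed.

Lemma W1_norm_ge_series a N : series (W1_term a) N <= W1_norm a.
Proof.
rewrite /W1_norm; apply: nondecreasing_cvgn_le; last exact: W1_cvg.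
by apply: nondecreasing_series => n _ _; exact: W1_term_ge0.
Qed.

Lemma W1_norm_le u (cu : u \in W1_pred) e :
  (forall N, series (W1_term u) N <= e) -> W1_norm (MkW1 cu) <= e.
Proof. by move=> ue; apply: limr_le; [exact/W1_predP|exact: nearW]. Qed.

Lemma W1_normD a b : W1_norm (a + b) <= W1_norm a + W1_norm b.
Proof.
rewrite /W1_norm -lim_seriesD; [|exact: W1_cvg..].
apply: lim_series_le; first exact: W1_cvg.
  by apply: is_cvg_seriesD; exact: W1_cvg.
exact: W1_termD.
Qed.

Lemma W1_normZ k a : W1_norm (k *: a) = `|k| * W1_norm a.
Proof. by rewrite /W1_norm /= W1_termZ lim_seriesZ //; exact: W1_cvg. Qed.

Lemma W1_normr0_eq0 a : W1_norm a = 0 -> a = 0.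
Proof.
move=> a0; apply/val_inj/funext => n /=.
have := W1_norm_ge_series a n.+1; rewrite a0 seriesSr => H.
have sn : 0 <= series (W1_term a) n.
  by rewrite /series /= sumr_ge0 // => i _; exact: W1_term_ge0.
have : W1_term a n <= 0 by apply: le_trans H; rewrite lerDr.
rewrite /W1_term pmulr_lle0 ?invr_gt0 ?ltr0n ?fact_gt0 //.
by rewrite normr_le0 => /eqP.
Qed.

HB.instance Definition _ :=
  Lmodule_isNormed.Build R W1 W1_normD W1_normZ W1_normr0_eq0.

Lemma W1_normE a : `|a| = limn (series (W1_term a)).
Proof. by []. Qed.

Lemma W1_coord_le a n : `|a n| <= (n.+2)`!%:R * `|a|.
Proof.
rewrite mulrC -ler_pdivrMr ?ltr0n ?fact_gt0 // -/(W1_term a n).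
apply: le_trans (W1_norm_ge_series a n.+1); rewrite seriesSr lerDr.
by rewrite /series /= sumr_ge0 // => i _; exact: W1_term_ge0.
Qed.

Lemma W1_cauchy_cvg (F : set_system W1) :
  ProperFilter F -> cauchy F -> cvg F.
Proof.
move=> FF /cauchyP Fc.
have coord n : cvg ((fun a : W1 => a n) @ F).
  apply/cauchy_cvgP/cauchyP => e e0.
  have e'0 : 0 < e / (n.+2)`!%:R by rewrite divr_gt0 ?ltr0n ?fact_gt0.
  have [x Fx] := Fc _ e'0; exists ((x : W1) n).
  suff : \forall y \near F, ball ((x : W1) n) e ((y : W1) n) by [].
  apply: filterS Fx => y.
  move=> xy; have {xy} : `|x - y| < e / (n.+2)`!%:R.
    by move: xy; rewrite -ball_normE.
  rewrite ltr_pdivlMr ?ltr0n ?fact_gt0 // => xy.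
  rewrite -ball_normE /=.
  by apply: le_lt_trans xy; rewrite mulrC; exact: (W1_coord_le (x - y) n).
pose l n : R := lim ((fun a : W1 => a n) @ F).
have Fl e : 0 < e ->
    \forall x \near F, forall N, series (W1_term (W1_seq x - l)) N <= e.
  move=> e0; have e20 : 0 < e / 2 by rewrite divr_gt0.
  have [z Fz] := Fc _ e20; apply: filterS (Fz) => x zx N.
  apply: (@cvgr_to_le _ F FF R
    (fun y : W1 => series (W1_term (W1_seq x - y)) N)).
    elim: N => [|N IH].
      rewrite /series /= !big_nil; under eq_fun do rewrite big_nil.
      exact: cvg_cst.
    rewrite seriesSr; under eq_fun do rewrite seriesSr.
    apply: cvgD => //; apply: cvgMl.
    by apply: cvg_norm; apply: cvgB; [exact: cvg_cst|exact: coord].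
  apply: filterS Fz => y zy; apply: le_trans (W1_norm_ge_series (x - y) N) _.
  by have := ball_splitr zx zy; rewrite -ball_normE => /ltW.
have Wl : l \in W1_pred.
  have [x Fx] := filter_ex (Fl 1 ltr01).
  have xl : W1_seq x - l \in W1_pred.
    apply/W1_predP/nondecreasing_is_cvgn.
      by apply: nondecreasing_series => n _ _; exact: W1_term_ge0.
    by exists 1 => _ [N _ <-].
  have -> : l = W1_seq x - (W1_seq x - l) by rewrite opprB addrC subrK.
  by rewrite rpredB //; exact: valP x.
apply/cvg_ex; exists (MkW1 Wl : W1); apply/cvgrPdist_le => e e0.
apply: filterS (Fl e e0) => x xe; rewrite distrC.
by apply: limr_le; [exact: W1_cvg|exact: nearW].
Qed.

HB.instance Definition _ := Uniform_isComplete.Build W1 W1_cauchy_cvg.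

End W1.
Arguments W1_pred {R}.

Section Analytic.
Variables (R : realType) (E F : normedModType R).

Definition multilinear n (M : ('I_n -> E) -> F) :=
  forall (v : 'I_n -> E) (i : 'I_n),
    linear (fun x : E => M (fun j => if j == i then x else v j)).

(* [M] is continuous, with operator norm at most [C]. *)
Definition mbounded n (M : ('I_n -> E) -> F) (C : R) :=
  forall v : 'I_n -> E, `|M v| <= C * \prod_(i < n) `|v i|.

(* Near [x], [f] is the sum of a power series \sum_n P_n(h) of continuous
   homogeneous polynomials P_n(h) = M_n(h, ..., h) that converges normally:
   \sum_n ||M_n|| r^n < oo for some r > 0.  M_n need not be symmetric, since
   only its values on the diagonal matter. *)
Definition analytic_at (f : E -> F) (x : E) :=
  exists (M : forall n, ('I_n -> E) -> F) (C : nat -> R) (r : R),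
    [/\ 0 < r,
        forall n, multilinear (M n) /\ mbounded (M n) (C n),
        cvgn (series (fun n => C n * r ^+ n)) &
        forall h : E, `|h| < r ->
          series (fun n => M n (fun=> h)) @ \oo --> f (x + h)].

Definition analytic (f : E -> F) := forall x, analytic_at f x.

End Analytic.

Section Diff1.
Variable R : realType.

Definition Diff1 : {pred Diffbar R} :=
  [pred g : Diffbar R | (fun n => g n.+2) \in W1_pred].

Definition W1_series (a : W1 R) : nat -> R :=
  fun n => if n is m.+2 then a m else (n == 1%N)%:R.

Lemma W1_series_subproof a : (W1_series a 0 == 0) && (W1_series a 1 == 1).
Proof. by rewrite /W1_series /= !eqxx. Qed.

Definition W1_Diff (a : W1 R) : Diffbar R := MkDiffbar (W1_series_subproof a).

Lemma W1_Diff_inj : injective W1_Diff.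
Proof.
move=> a b ab; apply/val_inj/funext => n.
by have := congr1 (fun g : Diffbar R => g n.+2) ab.
Qed.

Lemma W1_Diff_range : range W1_Diff = [set` Diff1].
Proof.
apply/seteqP; split=> [_ [a _ <-]|g /= gW]; first exact: (valP a).
exists (MkW1 gW) => //; apply/val_inj/funext => -[|[|n]] //=.
- by rewrite dcoef0.
- by rewrite dcoef1.
Qed.

End Diff1.
Arguments Diff1 R : clear implicits.

(* Main.v *)
(* For b = x^2(...), Taylor's formula f(x + b) = \sum_i f^(i) b^i / i! is a
   normally convergent series in W_1: since k! j! / (k + j)! <= 2 / ((k + 1)(k + 2))
   for j >= 2, its i-th term has norm at most 2^i / i! ||f|| ||b||^i.  Hence
   composition is defined on W_1, and it is a power series at (a_0, 0).

   If u = x^3(...), the equation h(x + u) = x for the coefficients of the inverse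
   series h expresses |h_k| / k! through earlier coefficients with total weight
   O(1 / k), which bounds the norm of h.  The general case follows by first
   composing with x - a_2 x^2.

   Right translations are affine and continuous, so analyticity anywhere reduces
   to a neighbourhood of the identity: x + b + h = (x + h o (x + b)^-1) o (x + b).
   There the operator f |-> f o (x + u) is the identity plus a small power series
   in u, and its inverse f |-> f o (x + u)^-1 is given by a Neumann series. *)

Require Import Defs.
From mathcomp Require Import all_boot all_order all_algebra.
From mathcomp Require Import all_classical all_reals all_analysis.
From mathcomp Require Import ring lra zify.

Set Implicit Arguments.
Unset Strict Implicit.
Unset Printing Implicit Defensive.

Import Order.TTheory GRing.Theory Num.Theory.
Import numFieldNormedType.Exports.

Local Open Scope classical_set_scope.
Local Open Scope ring_scope.

(** Raising j by one multiplies (p + j)! / j! by (p + j + 1) / (j + 1) >= 1. *)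
Lemma fact_mul_le p q j : (q <= j)%N ->
  (j`! * (p + q)`! <= q`! * (p + j)`!)%N.
Proof.
elim: j => [|j IH]; first by rewrite leqn0 => /eqP ->.
rewrite leq_eqVlt => /orP[/eqP <-|]; first by [].
rewrite ltnS => /IH {}IH; rewrite addnS !factS -mulnA [X in (_ <= X)%N]mulnCA.
by apply: leq_mul => //; rewrite ltnS leq_addl.
Qed.

(** (k + i)! is k! times the falling factorial of k + i of length i, which is monotone in its
    base. *)
Lemma ffact_fact_le k i : (k ^_ i * k`! <= (k + i)`!)%N.
Proof.
rewrite -(@ffact_fact (k + i) i) ?leq_addl // addnK leq_mul2r.
apply/orP; right; move: (k + i)%N (leq_addr i k) => m km.
by elim: i => // i IH; rewrite !ffactnSr leq_mul // leq_sub2r.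
Qed.

(** * Taylor's formula and weighted norms of formal series *)

Section Taylor.
Variable R : realType.
Implicit Types (f g b : nat -> R) (p : {poly R}) (s : seq (nat -> R)).

Lemma sum_triangle (V : nmodType) (F : nat -> nat -> V) N :
  \sum_(n < N) \sum_(m < n.+1) F m (n - m)%N =
  \sum_(m < N) \sum_(j < N - m) F m j.
Proof.
elim: N => [|N IH]; first by rewrite !big_ord0.
rewrite big_ord_recr IH /= [RHS]big_ord_recr /= subSn // subnn big_ord1.
rewrite [X in _ + X]big_ord_recr /= subnn addrA -big_split /=; congr (_ + _).
by apply: eq_bigr => i _; rewrite subSn 1?ltnW // big_ord_recr.
Qed.

(** Partial sums of the W_1 norm in true degrees; being finite, they also apply to series not yet
    known to lie in W_1. *)
Definition wsum N f : R := \sum_(n < N) `|f n| / n`!%:R.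

Lemma wsum_ge0 N f : 0 <= wsum N f.
Proof. by rewrite sumr_ge0 // => i _; rewrite divr_ge0. Qed.

(* The weight of x^m when l factors of order at least q are still to be
   multiplied: these raise the degree to at least m + q l. *)
Definition weight q l m : R := (q`! ^ l)%:R / (m + q * l)`!%:R.

Lemma weight_ge0 q l m : 0 <= weight q l m.
Proof. exact: divr_ge0. Qed.

Lemma factr_gt0 n : 0 < n`!%:R :> R.
Proof. by rewrite ltr0n fact_gt0. Qed.

(** [fact_mul_le] with p = m + q l: a factor x^j of order at least q is absorbed by raising l. *)
Lemma weight_add q l m j : (q <= j)%N ->
  weight q l (m + j) <= weight q l.+1 m * j`!%:R^-1.
Proof.
move=> qj; rewrite /weight -mulrA -invfM -natrM.
rewrite ler_pdivrMr ?factr_gt0 // mulrAC ler_pdivlMr ?ltr0n ?muln_gt0 ?fact_gt0 //.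
rewrite -!natrM ler_nat; have := fact_mul_le (m + q * l) qj.
rewrite mulnS addnA [(m + q + _)%N]addnAC [(m + j + _)%N]addnAC expnSr.
by move=> H; rewrite -mulnA leq_mul2l [X in (X <= _)%N]mulnC H orbT.
Qed.

Lemma wsum_coefM q l N p g :
  (forall j, (j < q)%N -> g j = 0) ->
  \sum_(n < N) `|(p * \poly_(j < N) g j)`_n| * weight q l n <=
  (\sum_(m < N) `|p`_m| * weight q l.+1 m) * wsum N g.
Proof.
move=> g0.
pose F m j : R := `|p`_m| * `|g j| * weight q l (m + j).
have F0 m j : 0 <= F m j by rewrite !mulr_ge0 ?weight_ge0.
apply: (@le_trans _ _ (\sum_(n < N) \sum_(m < n.+1) F m (n - m)%N)).
  apply: ler_sum => n _; rewrite coefM.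
  apply: le_trans (ler_wpM2r (weight_ge0 _ _ _) (ler_norm_sum _ _ _)) _.
  rewrite mulr_suml; apply: ler_sum => m _.
  rewrite normrM coef_poly ifT; last by have := ltn_ord n; lia.
  by rewrite /F subnKC // -ltnS.
rewrite sum_triangle mulr_suml; apply: ler_sum => m _.
(* The triangle m + j < N is enlarged to a square of nonnegative terms. *)
rewrite mulr_sumr; apply: le_trans (_ : \sum_(j < N) F m j <= _).
  rewrite -!(big_mkord xpredT (F m)).
  rewrite [leRHS](@big_cat_nat _ _ _ (N - m)%N) ?leq_subr //=.
  by rewrite lerDl sumr_ge0.
apply: ler_sum => j _; rewrite /F.
have [jq|qj] := ltnP j q; first by rewrite g0 // normr0 mulr0 !mul0r mulr0.
by rewrite [leRHS]mulrACA ler_wpM2l ?weight_add // mulr_ge0.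
Qed.

Lemma wsum_coefM_prod q l N p s :
  (forall b, List.In b s -> forall j, (j < q)%N -> b j = 0) ->
  \sum_(n < N) `|(p * \prod_(b <- s) \poly_(j < N) b j)`_n| * weight q l n <=
  (\sum_(m < N) `|p`_m| * weight q (l + size s) m) * \prod_(b <- s) wsum N b.
Proof.
elim: s l => [|b s IH] l s0; first by rewrite !big_nil !mulr1 addn0.
rewrite !big_cons mulrA mulrAC; apply: le_trans (wsum_coefM _ _ _ _) _.
  by apply: s0; left.
rewrite [wsum N b * _]mulrC mulrA ler_wpM2r ?wsum_ge0 // addnS -addSn.
by apply: IH => c cs; apply: s0; right.
Qed.

(* The coefficients of the divided derivative f^(i) / i!. *)
Definition taylor_coef i f : nat -> R := fun m => f (i + m)%N *+ 'C(i + m, i).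

(** The term f^(i) b^i / i! of Taylor's formula, polarized: independent factors make it multilinear,
    as analyticity requires. *)
Definition taylor_term s f : nat -> R := fun n =>
  (\poly_(m < n.+1) taylor_coef (size s) f m *
   \prod_(b <- s) \poly_(j < n.+1) b j)`_n.

Lemma taylor_termE N s f n : (n < N)%N -> taylor_term s f n =
  (\poly_(m < N) taylor_coef (size s) f m * \prod_(b <- s) \poly_(j < N) b j)`_n.
Proof.
move=> nN; have trunc g :
    eqmodX n.+1 (\poly_(m < n.+1) g m : {poly R}) (\poly_(m < N) g m).
  by move=> i iN; rewrite !coef_poly iN (leq_trans iN nN).
apply: (@eqmodX_mul _ n.+1) => //.
by elim: s => [|b s IH]; rewrite ?big_nil // !big_cons; apply: eqmodX_mul.
Qed.

Lemma wsum_taylor_term q N s f :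
  (forall b, List.In b s -> forall j, (j < q)%N -> b j = 0) ->
  wsum N (taylor_term s f) <=
  (\sum_(m < N) `|taylor_coef (size s) f m| * weight q (size s) m) *
  \prod_(b <- s) wsum N b.
Proof.
move=> s0; rewrite {1}/wsum.
under [leLHS]eq_bigr => n _ do rewrite (@taylor_termE N) //.
have := wsum_coefM_prod 0 N (\poly_(m < N) taylor_coef (size s) f m) s0.
rewrite /weight muln0 expn0; under [leLHS]eq_bigr => n _ do rewrite addn0 mul1r.
move=> /le_trans; apply; rewrite add0n le_eqVlt; apply/orP; left; apply/eqP.
by congr (_ * _); apply: eq_bigr => m _; rewrite coef_poly ltn_ord.
Qed.

Lemma coef_prod_lt q N s n :
  (forall b, List.In b s -> forall j, (j < q)%N -> b j = 0) ->
  (n < q * size s)%N -> (\prod_(b <- s) \poly_(j < N) b j)`_n = 0.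
Proof.
elim: s n => [|b s IH] n s0; first by rewrite /= muln0.
rewrite big_cons /= mulnS => ns; rewrite coefM big1 // => -[j jn] _ /=.
have [jq|qj] := ltnP j q.
  by rewrite coef_poly s0 ?if_same ?mul0r //; left.
rewrite IH ?mulr0 //; first by move=> c cs; apply: s0; right.
by move: ns jn qj; lia.
Qed.

(** Passing to f^(i) lowers the order by at most i, and the i factors without constant term restore
    it. *)
Lemma taylor_term_low s f N n :
  (forall b, List.In b s -> forall j, (j < 1)%N -> b j = 0) ->
  (forall k, (k < N)%N -> f k = 0) -> (n < N)%N -> taylor_term s f n = 0.
Proof.
move=> s0 f0 nN; rewrite /taylor_term coefM big1 // => -[j jn] _ /=.
have [jN|Nj] := ltnP (size s + j) N.
  by rewrite coef_poly /taylor_coef f0 // mul0rn if_same mul0r.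
by rewrite (@coef_prod_lt 1) ?mulr0 //; move: jn Nj nN; lia.
Qed.

(** Expand each (x + b)^k by the binomial formula and collect by the exponent i of b; the sums are
    finite because b has no constant term. *)
Lemma taylor f b N n : b 0 = 0 -> (n < N)%N ->
  fs_subst f (fs_id \+ b) n = \sum_(i < N) taylor_term (nseq i b) f n.
Proof.
move=> b0 nN; set B : {poly R} := \poly_(j < N) b j.
have B0 : B`_0 = 0 by rewrite coef_poly b0 if_same.
have XB0 i m : (n < i + m)%N -> ('X^m * B ^+ i)`_n = 0.
  by move=> nim; rewrite coefXnM; case: ltnP => // mn; rewrite coef_exp_lt //; lia.
pose F i m : R := f (i + m)%N *+ 'C(i + m, i) * ('X^m * B ^+ i)`_n.
have F0 i m : (n < i + m)%N -> F i m = 0 by move=> nim; rewrite /F XB0 ?mulr0.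
transitivity (\sum_(k < N) \sum_(i < k.+1) F i (k - i)%N).
  rewrite (@fs_substE _ _ _ N) //; last by rewrite /= b0 addr0.
  have -> : \poly_(i < N) (fs_id \+ b) i = \poly_(i < N) fs_id i + B.
    by apply/polyP => i; rewrite coefD !coef_poly; case: ifP; rewrite ?addr0.
  rewrite (@coef_comp_trunc _ _ _ N) //; last first.
    by rewrite coefD B0 addr0 coef_poly if_same.
  apply: eq_bigr => k _; rewrite coef_poly ltn_ord.
  have XE : eqmodX N (\poly_(i < N) fs_id i + B) ('X + B).
    by move=> i iN; rewrite !coefD coef_poly iN coefX.
  rewrite (eqmodX_exp k XE nN) exprDn coef_sum mulr_sumr.
  apply: eq_bigr => i _; rewrite coefMn /F subnKC; last by rewrite -ltnS.
  by rewrite mulrnAr mulrnAl.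
rewrite sum_triangle; apply: eq_bigr => i _.
rewrite (@taylor_termE N) // size_nseq poly_def mulr_suml coef_sum.
(* The terms with m >= N - i vanish: their order is at least i + m > n. *)
transitivity (\sum_(m < N) F i m).
  rewrite -!(big_mkord xpredT (F i)).
  rewrite [RHS](@big_cat_nat _ _ _ (N - i)%N) ?leq_subr //=.
  rewrite [X in _ = _ + X]big_nat_cond [X in _ = _ + X]big1 ?addr0 //.
  move=> m /andP[/andP[]]; rewrite leq_subLR => im _ _; rewrite F0 //.
  exact: leq_trans nN im.
apply: eq_bigr => m _; rewrite -scalerAl coefZ big_nseq.
suff -> : iter i (fun y => B * y) 1 = B ^+ i by [].
by elim: (nat_of_ord i) => // k IH; rewrite exprS -IH.
Qed.

(* With k = i + m this is C(k, i) k! / (k + i)! <= 1 / i!; the next lemma is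
   C(k, i) k! / (k + 2 i)! <= 1 / (i! (k + 1)), for i >= 1. *)
Lemma taylor_weight2 N i f :
  \sum_(m < N) `|taylor_coef i f m| * weight 2 i m <=
  (2 ^+ i / i`!%:R) * wsum (i + N) f.
Proof.
rewrite /wsum big_split_ord /= mulrDr -[leLHS]add0r lerD //.
  by rewrite mulr_ge0 // sumr_ge0 // => k _; rewrite divr_ge0.
rewrite mulr_sumr; apply: ler_sum => m _.
have H : 'C(i + m, i)%:R * weight 2 i m <= 2 ^+ i / i`!%:R / (i + m)`!%:R.
  rewrite /weight (_ : m + 2 * i = i + m + i)%N; last by lia.
  rewrite mulrA -natrM -[leRHS]mulrA -invfM -natrM ler_pdivrMr ?factr_gt0 //.
  rewrite mulrAC ler_pdivlMr ?ltr0n ?muln_gt0 ?fact_gt0 //.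
  rewrite -natrX -!natrM ler_nat; have := ffact_fact_le (i + m) i.
  rewrite -bin_ffact; set F2 := (2`! ^ i)%N.
  have -> : F2 = (2 ^ i)%N by []; nia.
apply: le_trans (_ : `|f (i + m)%N| * (2 ^+ i / i`!%:R / (i + m)`!%:R) <= _).
  by rewrite /taylor_coef normrMn -[_ *+ 'C(_, _)]mulr_natr -mulrA ler_wpM2l.
by rewrite [leLHS]mulrCA mulrA.
Qed.

Lemma taylor_weight3 N i f :
  \sum_(m < N) `|taylor_coef i.+1 f m| * weight 3 i.+1 m <=
  (6 ^+ i.+1 / i.+1`!%:R) *
    \sum_(k < i.+1 + N) `|f k| / k`!%:R / k.+1%:R.
Proof.
rewrite big_split_ord /= mulrDr -[leLHS]add0r lerD //.
  by rewrite mulr_ge0 // sumr_ge0 // => k _; rewrite !divr_ge0.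
rewrite mulr_sumr; apply: ler_sum => m _; set k := (i.+1 + m)%N.
have H : 'C(k, i.+1)%:R * weight 3 i.+1 m <=
    6 ^+ i.+1 / i.+1`!%:R / k`!%:R / k.+1%:R.
  rewrite /weight (_ : m + 3 * i.+1 = (k + i.+1 + i).+1)%N; last by rewrite /k; lia.
  have -> : 6 ^+ i.+1 / i.+1`!%:R / k`!%:R / k.+1%:R =
      (6 ^ i.+1)%:R / (i.+1`! * k`! * k.+1)%:R :> R.
    by rewrite !natrM natrX !invfM !mulrA.
  rewrite mulrA -natrM ler_pdivrMr ?factr_gt0 //.
  rewrite mulrAC ler_pdivlMr ?ltr0n ?muln_gt0 ?fact_gt0 //.
  rewrite -!natrM ler_nat; have := ffact_fact_le k i.+1.
  (* Order 3 instead of 2 adds i + 1 to the degree; one of these units already yields the factor k +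
     1. *)
  have H2 : (k.+1 * (k + i.+1)`! <= (k + i.+1 + i).+1`!)%N.
    rewrite factS; apply: leq_mul; first by rewrite ltnS -addnA leq_addr.
    by apply: leq_fact; rewrite leq_addr.
  rewrite -bin_ffact; set F3 := (3`! ^ i.+1)%N; have -> : F3 = (6 ^ i.+1)%N by [].
  move: (k`!) (i.+1`!) ((k + i.+1)`!) ((k + i.+1 + i).+1`!) H2 => a b c d H2 H3.
  have H4 : (k.+1 * ('C(k, i.+1) * b * a) <= d)%N.
    by apply: leq_trans H2; rewrite leq_mul2l H3 orbT.
  move: H4 (6 ^ i.+1)%N; move: ('C(_, _)) => e H4 F.
  have -> : (e * F * (b * a * k.+1) = F * (k.+1 * (e * b * a)))%N.
    by ring.
  by rewrite leq_mul2l H4 orbT.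
apply: le_trans (_ : `|f k| * (6 ^+ i.+1 / i.+1`!%:R / k`!%:R / k.+1%:R) <= _).
  by rewrite /taylor_coef normrMn -[_ *+ 'C(_, _)]mulr_natr -mulrA ler_wpM2l.
by rewrite -!mulrA [leLHS]mulrCA [X in _ * X <= _]mulrCA.
Qed.
End Taylor.

(** * Linearity of the Taylor terms, and W_1 as a space of series *)

Section Shift.
Variable R : realType.
Implicit Types (f g u v : nat -> R) (s : seq (nat -> R)).

Lemma trunc_linear N : linear (fun f => \poly_(j < N) f j : {poly R}).
Proof.
move=> k f g; apply/polyP => i; rewrite coefD coefZ !coef_poly.
by case: ifP => // _; rewrite mulr0 addr0.
Qed.

Lemma taylor_coef_linear i : linear (@taylor_coef R i).
Proof.
move=> k f g; apply/funext => m; rewrite /taylor_coef mulrnDl; congr (_ + _).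
exact: esym (mulrnAr _ _ _).
Qed.

Lemma taylor_term_linear s : linear (taylor_term s).
Proof.
move=> k f g; apply/funext => n; rewrite /taylor_term taylor_coef_linear.
by rewrite trunc_linear mulrDl -scalerAl coefD coefZ.
Qed.

Lemma taylor_term_multilinear s1 s2 f :
  linear (fun g => taylor_term (s1 ++ g :: s2) f).
Proof.
move=> k g h; apply/funext => n.
transitivity (k * taylor_term (s1 ++ g :: s2) f n +
  taylor_term (s1 ++ h :: s2) f n) => //.
rewrite /taylor_term !size_cat !big_cat !big_cons /= trunc_linear.
by rewrite mulrDl -scalerAl 2!mulrDr -2!scalerAr coefD coefZ.
Qed.

Lemma fs_subst_linear g : linear (fun f => fs_subst f g).
Proof.
move=> k f h; apply/funext => n; rewrite /fs_subst.
under eq_bigr => i _ do rewrite mulrDl -mulrA.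
by rewrite big_split /= -mulr_sumr.
Qed.

Lemma le_wsum M N f : (M <= N)%N -> wsum M f <= wsum N f.
Proof.
move=> MN; rewrite /wsum -!(big_mkord xpredT (fun n => `|f n| / n`!%:R)).
by rewrite [leRHS](@big_cat_nat _ _ _ M) //= lerDl sumr_ge0 //.
Qed.

(** The displacement gamma(x) - x of a diffeomorphism, from its coordinates in W_1, which are stored
    from index 0. *)
Definition shift2 u : nat -> R := fun n => if n is m.+2 then u m else 0.

Lemma shift2_linear : linear shift2.
Proof.
by move=> k u v; apply/funext => -[|[|n]] //=; rewrite ?[RHS]addr0 ?[RHS]mulr0.
Qed.

Lemma wsum_shift2 N u : wsum N.+2 (shift2 u) = series (W1_term u) N.
Proof.
rewrite /wsum 2!big_ord_recl /= !normr0 !mul0r !add0r.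
by rewrite /series /= -(big_mkord xpredT (W1_term u)).
Qed.

Lemma wsum_shift2_le N (a : W1 R) : wsum N (shift2 a) <= `|a|.
Proof.
apply: le_trans (W1_norm_ge_series a N); rewrite -wsum_shift2.
by apply: le_wsum; lia.
Qed.

Lemma W1_pred_bound u B :
  (forall N, series (W1_term u) N <= B) -> u \in W1_pred.
Proof.
move=> uB; apply/W1_predP/nondecreasing_is_cvgn.
  by apply: nondecreasing_series => n _ _; exact: W1_term_ge0.
by exists B => _ [N _ <-].
Qed.

Lemma W1_pred_wsum f B : (forall N, wsum N f <= B) ->
  (fun n => f n.+2) \in W1_pred.
Proof.
move=> fB; apply: (@W1_pred_bound _ B) => N; apply: le_trans (fB N.+2).
rewrite -wsum_shift2; apply: ler_sum => -[[|[|n]] nN] _ //=.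
  by rewrite normr0 mul0r divr_ge0.
by rewrite normr0 mul0r divr_ge0.
Qed.

End Shift.

(** * Composition on [W1] *)

Section W1Taylor.
Variable R : realType.
Implicit Types (a b c h : W1 R) (s : seq (W1 R)).

Definition W1_taylor_seq s a : nat -> R :=
  fun n => taylor_term [seq shift2 (W1_seq b) | b <- s] (shift2 a) n.+2.

Lemma shift2_below s (g : nat -> R) :
  List.In g [seq shift2 (W1_seq b) | b <- s] ->
  forall j, (j < 2)%N -> g j = 0.
Proof. by elim: s => //= c s IH [<- [|[|]]|/IH]. Qed.

(** An instance of [taylor_weight2], as elements of W_1 start at x^2. The factorial in the
    denominator makes the Taylor series converge for every b. *)
Lemma W1_taylor_seq_bound s a N : series (W1_term (W1_taylor_seq s a)) N <=
  2 ^+ size s / (size s)`!%:R * `|a| * \prod_(b <- s) `|b|.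
Proof.
rewrite -wsum_shift2.
apply: (@le_trans _ _ (wsum N.+2
    (taylor_term [seq shift2 (W1_seq b) | b <- s] (shift2 a)))).
  apply: ler_sum => -[[|[|n]] nN] _ //=; rewrite normr0 mul0r divr_ge0 //.
apply: le_trans (wsum_taylor_term _ _ (@shift2_below s)) _.
apply: ler_pM.
- by rewrite sumr_ge0 // => i _; rewrite mulr_ge0 ?weight_ge0.
- by rewrite prodr_ge0 // => i _; rewrite wsum_ge0.
- apply: le_trans (taylor_weight2 _ _ _) _.
  rewrite size_map ler_wpM2l ?wsum_shift2_le //.
rewrite big_map; elim: s => [|b s IH]; first by rewrite !big_nil.
rewrite !big_cons ler_pM ?wsum_ge0 ?wsum_shift2_le //.
by rewrite prodr_ge0 // => i _; rewrite wsum_ge0.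
Qed.

Lemma W1_taylor_subproof s a : W1_taylor_seq s a \in W1_pred.
Proof. exact: W1_pred_bound (W1_taylor_seq_bound s a). Qed.

Definition W1_taylor s a : W1 R := MkW1 (W1_taylor_subproof s a).

Lemma W1_taylor_le s a : `|W1_taylor s a| <=
  2 ^+ size s / (size s)`!%:R * `|a| * \prod_(b <- s) `|b|.
Proof. by apply: W1_norm_le; exact: W1_taylor_seq_bound. Qed.

Lemma W1_taylor_linear s : linear (W1_taylor s).
Proof.
move=> k a b; apply/val_inj/funext => n /=.
by rewrite /W1_taylor_seq /= shift2_linear taylor_term_linear.
Qed.

Lemma W1_taylor_multilinear s1 s2 a :
  linear (fun b => W1_taylor (s1 ++ b :: s2) a).
Proof.
move=> k b c; apply/val_inj/funext => n /=.
by rewrite /W1_taylor_seq !map_cat /= shift2_linear taylor_term_multilinear.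
Qed.

Lemma W1_cvg_coord (u : nat -> W1 R) a n :
  u @ \oo --> a -> (fun k => (u k : W1 R) n) @ \oo --> (a : W1 R) n.
Proof.
move=> ua; apply/cvgrPdist_lt => e e0.
have e'0 : 0 < e / n.+2`!%:R by rewrite divr_gt0 ?factr_gt0.
have /cvgrPdist_lt/(_ _ e'0) := ua; apply: filterS => k.
rewrite ltr_pdivlMr ?factr_gt0 // mulrC; apply: le_lt_trans.
exact: (W1_coord_le (a - u k) n).
Qed.

Lemma normal_cvg (u : nat -> W1 R) (c : nat -> R) :
  (forall i, `|u i| <= c i) -> cvgn (series c) -> cvgn (series u).
Proof.
move=> uc cc; apply: normed_cvg.
apply: (@series_le_cvg _ _ c) => //= i.
exact: le_trans (uc i).
Qed.

(** The series a o (x + b) is introduced as a limit in W_1, which settles its membership;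
    [shift2_subst] identifies it with the formal substitution. *)
Definition W1_subst_term a b := series (fun i => W1_taylor (nseq i b) a).
Definition W1_subst a b : W1 R := limn (W1_subst_term a b).

Lemma W1_taylor_nseq_le i a b :
  `|W1_taylor (nseq i b) a| <= `|a| * exp_coeff (2 * `|b|) i.
Proof.
apply: le_trans (W1_taylor_le _ _) _; rewrite size_nseq big_nseq.
have -> : iter i ( *%R `|b|) 1 = `|b| ^+ i.
  by elim: i => // i IH; rewrite exprS -IH.
by rewrite /exp_coeff /= exprMn [_ / _ * `|a|]mulrC -[leLHS]mulrA mulrAC.
Qed.

Lemma W1_subst_cvg a b : W1_subst_term a b @ \oo --> W1_subst a b.
Proof.
apply: (@normal_cvg _ (fun i => `|a| * exp_coeff (2 * `|b|) i)).
  by move=> i; exact: W1_taylor_nseq_le.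
exact: (@is_cvg_seriesZ _ _ `|a| (is_cvg_series_exp_coeff _)).
Qed.

Lemma W1_subst_le a b : `|W1_subst a b| <= `|a| * expR (2 * `|b|).
Proof.
apply: (@cvgr_to_le _ \oo _ R (fun n => `|W1_subst_term a b n|)).
  by apply: cvg_norm; exact: W1_subst_cvg.
apply: nearW => n; apply: le_trans (ler_norm_sum _ _ _) _.
apply: le_trans (_ : `|a| * series (exp_coeff (2 * `|b|)) n <= _).
  rewrite /series /= mulr_sumr; apply: ler_sum => i _.
  exact: W1_taylor_nseq_le.
rewrite ler_wpM2l //; apply: nondecreasing_cvgn_le.
  apply: nondecreasing_series => i _ _.
  by rewrite /exp_coeff /= divr_ge0 // exprn_ge0 // mulr_ge0.
exact: is_cvg_series_exp_coeff.
Qed.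

(** Coordinates are continuous on W_1, and by [taylor] the coefficient of x^(n + 2) in the k-th
    partial sum is constant once k > n + 2. *)
Lemma shift2_subst a b :
  shift2 (W1_subst a b) = fs_subst (shift2 a) (fs_id \+ shift2 b).
Proof.
apply/funext => -[|[|n]] /=.
- by rewrite fs_subst0.
- by rewrite /fs_subst 2!big_ord_recl big_ord0 /= !mul0r !addr0.
have H := @W1_cvg_coord _ _ n (@W1_subst_cvg a b).
apply: (cvg_unique _ H) => //; apply: cvg_near_cst.
near=> k; rewrite (@taylor _ _ _ k) //; last by near: k; exact: nbhs_infty_gt.
have -> : W1_seq (W1_subst_term a b k) =
    \sum_(i < k) W1_seq (W1_taylor (nseq i b) a).
  rewrite /W1_subst_term /series /= big_mkord.
  by elim/big_rec2 : _ => // i x y _ <-.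
rewrite fct_sumE; apply: eq_bigr => i _.
by rewrite /= /W1_taylor_seq map_nseq.
Unshelve. all: by end_near.
Qed.
End W1Taylor.

(** * The group *)

Section Group.
Variable R : realType.
Implicit Types (a b c h u : W1 R).

(** [taylor_weight3] involves f_k for k < i + 1 + N. Since Taylor terms do not lower the order, f
    may first be cut off at N; the right-hand side then stops at N as well, as the absorption
    argument needs. *)
Lemma wsum_taylor_term3 N i (f b : nat -> R) :
  (forall j, (j < 3)%N -> b j = 0) ->
  wsum N (taylor_term (nseq i.+1 b) f) <=
  (6 ^+ i.+1 / i.+1`!%:R) *
    (\sum_(k < N) `|f k| / k`!%:R / k.+1%:R) * wsum N b ^+ i.+1.
Proof.
move=> b0; pose g k := if (k < N)%N then f k else 0.
have bIn q : (q <= 3)%N ->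
    forall w, List.In w (nseq i.+1 b) -> forall j, (j < q)%N -> w j = 0.
  move=> q3 w; elim: i.+1 => //= k IH [<-|//] j jq.
  by rewrite b0 // (leq_trans jq).
have fg n : (n < N)%N ->
    taylor_term (nseq i.+1 b) f n = taylor_term (nseq i.+1 b) g n.
  move=> nN; rewrite (_ : f = (1 : R) *: (f - g) + g :> (nat -> R)); last first.
    by rewrite scale1r subrK.
  rewrite taylor_term_linear; set t := taylor_term _ (f - g).
  transitivity (1 * t n + taylor_term (nseq i.+1 b) g n) => //.
  rewrite /t (@taylor_term_low _ _ _ N) ?mulr0 ?add0r //; first exact: (bIn 1%N).
  by move=> k kN; transitivity (f k - g k) => //; rewrite /g kN subrr.
rewrite {1}/wsum; under [leLHS]eq_bigr => n _ do rewrite fg //.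
apply: le_trans (wsum_taylor_term _ _ (bIn 3%N _)) _; first by [].
rewrite size_nseq big_nseq.
have -> : iter i.+1 ( *%R (wsum N b)) 1 = wsum N b ^+ i.+1.
  by elim: i.+1 => // k IH; rewrite exprS -IH.
rewrite ler_wpM2r ?exprn_ge0 ?wsum_ge0 //.
apply: le_trans (taylor_weight3 _ _ _) _.
rewrite ler_wpM2l // ?divr_ge0 ?exprn_ge0 //.
rewrite addnC big_split_ord /= [X in _ + X]big1 ?addr0 => [|k _].
  by apply: ler_sum => k _; rewrite /g ltn_ord.
by rewrite /g ltnNge leq_addr /= normr0 !mul0r.
Qed.

Lemma sum_exp_coeff_le (x : R) N : 0 <= x ->
  \sum_(i < N) x ^+ i.+1 / i.+1`!%:R <= expR x.
Proof.
move=> x0; apply: le_trans (_ : series (exp_coeff x) N.+1 <= _).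
  by rewrite /series /= big_mkord big_ord_recl lerDr /exp_coeff /= divr_ge0.
apply: nondecreasing_cvgn_le; last exact: is_cvg_series_exp_coeff.
apply: nondecreasing_series => i _ _.
by rewrite /exp_coeff /= divr_ge0 // exprn_ge0.
Qed.

(* [h o (id + u) = id] reads [h = id - \sum_(i >= 1) h^(i) u^i / i!].  As u
   starts at x^3, the sum weighs the coefficient h_k by O(1 / k), so all but
   finitely many of them are absorbed in the left-hand side. *)
Lemma wsum_left_inverse (f : nat -> R) u : u 0 = 0 ->
  fs_subst f (fs_id \+ shift2 u) = fs_id ->
  exists B, forall N, wsum N f <= B.
Proof.
move=> u0 fu; set b := shift2 u.
have b0 j : (j < 3)%N -> b j = 0 by case: j => [|[|[|]]].
set E := expR (6 * `|u|).
have E0 : 0 < E by exact: expR_gt0.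
(* The 1 bounds the norm of id, and E bounds the sum over i >= 1 of (6 |u|)^i / i!. *)
have bound N : wsum N f <= 1 + E * \sum_(k < N) `|f k| / k`!%:R / k.+1%:R.
  case: N => [|N]; first by rewrite /wsum !big_ord0 mulr0 addr0 ler01.
  set S := \sum_(k < _) _.
  have S0 : 0 <= S by rewrite sumr_ge0 // => k _; rewrite !divr_ge0.
  apply: (@le_trans _ _ (wsum N.+1 fs_id +
      \sum_(i < N) wsum N.+1 (taylor_term (nseq i.+1 b) f))).
    rewrite /wsum exchange_big -big_split; apply: ler_sum => n _ /=.
    rewrite -mulr_suml -mulrDl ler_wpM2r ?invr_ge0 //.
    have := @taylor _ f b N.+1 n (b0 0%N isT) (ltn_ord n).
    rewrite fu big_ord_recl.
    have -> : taylor_term (nseq (ord0 : 'I_N.+1) b) f n = f n.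
      rewrite /taylor_term big_nil mulr1 coef_poly ltnSn /taylor_coef add0n.
      by rewrite bin0.
    move=> /eqP; rewrite -subr_eq => /eqP <-.
    by apply: le_trans (ler_normB _ _) _; rewrite lerD2l ler_norm_sum.
  apply: lerD.
    rewrite /wsum; case: N @S S0 => [|N] S S0.
      by rewrite big_ord1 normr0 mul0r ler01.
    rewrite 2!big_ord_recl big1 ?addr0 /= => [|i _]; last by rewrite normr0 mul0r.
    by rewrite normr0 mul0r add0r normr1 divr1.
  apply: le_trans (_ : \sum_(i < N) ((6 * `|u|) ^+ i.+1 / i.+1`!%:R) * S <= _).
    apply: ler_sum => i _; apply: le_trans (wsum_taylor_term3 _ _ _ b0) _.
    apply: (@le_trans _ _ (6 ^+ i.+1 / i.+1`!%:R * S * `|u| ^+ i.+1)).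
      rewrite ler_wpM2l ?mulr_ge0 ?exprn_ge0 //.
      by rewrite lerXn2r ?nnegrE ?wsum_ge0 // wsum_shift2_le.
    by rewrite exprMn -!mulrA [X in _ <= _ * X]mulrC -!mulrA.
  by rewrite -mulr_suml ler_wpM2r // sum_exp_coeff_le // mulr_ge0.
(* From index K on, E / (k + 1) <= 1 / 2, so the tail of the sum is at most half of the left-hand
   side; this doubles the remaining bound. *)
have [K EK] : exists K : nat, 2 * E <= K.+1%:R.
  exists (Num.truncn (2 * E)); apply: ltW; exact: truncnS_gt.
exists (2 * (1 + E * wsum K f)) => M.
apply: le_trans (le_wsum _ (leq_addl K M)) _.
have := bound (K + M)%N; rewrite big_split_ord /=.
set T1 := \sum_(k < K) _; set T2 := \sum_(k < M) _.
have T1le : T1 <= wsum K f.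
  apply: ler_sum => k _; rewrite ler_pdivrMr ?ltr0n // ler_peMr ?divr_ge0 //.
  by rewrite ler1n.
have T2le : 2 * (E * T2) <= wsum (K + M) f.
  rewrite {1}/wsum big_split_ord /= -[leLHS]add0r lerD ?wsum_ge0 //.
  rewrite mulrA mulr_sumr; apply: ler_sum => k _.
  rewrite mulrCA ler_piMr ?divr_ge0 // ler_pdivrMr ?ltr0n // mul1r.
  by apply: le_trans EK _; rewrite ler_nat ltnS leq_addr.
have : E * T1 <= E * wsum K f by rewrite ler_wpM2l // ltW.
by rewrite mulrDr; move: T2le; lra.
Qed.

Lemma W1_seriesE a : W1_series a = fs_id \+ shift2 a.
Proof.
by apply/funext => -[|[|n]]; rewrite /W1_series /fs_id /= ?addr0 ?add0r.
Qed.

(** (x + a) o (x + b) = x + b + a o (x + b), as substitution is linear in the outer series. *)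
Lemma W1_Diff_mul a b :
  W1_Diff (b + W1_subst a b) = (W1_Diff a * W1_Diff b)%g.
Proof.
apply/val_inj; rewrite /= !W1_seriesE -[fs_id \+ shift2 b in RHS]W1_seriesE.
have -> : fs_id \+ shift2 a = (1 : R) *: fs_id + shift2 a :> (nat -> R).
  by rewrite scale1r.
rewrite fs_subst_linear fs_subst1x // W1_seriesE -shift2_subst scale1r.
have -> : W1_seq (b + W1_subst a b) = (1 : R) *: W1_seq b + W1_subst a b.
  by rewrite scale1r.
by rewrite shift2_linear scale1r; apply/funext => n; exact: addrA.
Qed.

Lemma W1_Diff0 : W1_Diff 0 = 1%g :> Diffbar R.
Proof. by apply/val_inj/funext => -[|[|n]]. Qed.

Lemma W1_Diff_in a : W1_Diff a \in Diff1 R.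
Proof. exact: (valP a). Qed.

Lemma Diff1P (g : Diffbar R) : g \in Diff1 R -> exists a, g = W1_Diff a.
Proof.
move=> gD; have : [set` Diff1 R] g by [].
by rewrite -W1_Diff_range => -[a _ <-]; exists a.
Qed.

(** [u 0] is the coefficient of x^2, so [wsum_left_inverse] bounds the norm of the formal
    inverse. *)
Lemma W1_Diff_inv3 u : u 0 = 0 -> ((W1_Diff u)^-1)%g \in Diff1 R.
Proof.
move=> u0; have [|B fB] := @wsum_left_inverse (fs_inv (W1_series u)) u u0.
  by rewrite -W1_seriesE fs_subst_invl.
exact: W1_pred_wsum fB.
Qed.

Lemma quad_subproof (x : R) : (fun n => if n is 0%N then x else 0) \in W1_pred.
Proof.
apply: (@W1_pred_bound _ _ (`|x| / 2`!%:R)) => -[|N].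
  by rewrite /series /= big_geq ?divr_ge0.
rewrite /series /= big_mkord big_ord_recl big1 ?addr0 // => i _.
by rewrite /W1_term normr0 mul0r.
Qed.

Definition quad (x : R) : W1 R := MkW1 (quad_subproof x).

(* Composing with x - a_2 x^2 removes the coefficient of x^2. *)
Lemma W1_Diff_inv a : ((W1_Diff a)^-1)%g \in Diff1 R.
Proof.
pose c := quad (- a 0%N); pose d := c + W1_subst a c.
(* Composition with x + c leaves the x^2 coefficient of a unchanged, and c contributes its
   opposite. *)
have d0 : d 0%N = 0.
  have E : W1_subst a c 0%N = a 0%N.
    have /(congr1 (@^~ 2%N)) /= -> := shift2_subst a c.
    rewrite /fs_subst 3!big_ord_recl big_ord0 /= !mul0r !add0r addr0.
    by rewrite coef_exp_diag ?mulr1 ?coef_poly //= addr0.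
  by rewrite -[LHS]/(- a 0%N + W1_subst a c 0%N) E addNr.
have [e eE] := Diff1P (W1_Diff_inv3 d0).
(* x + d = (x + a) o (x + c), so only x + d has to be inverted. *)
have -> : ((W1_Diff a)^-1 = W1_Diff c * (W1_Diff d)^-1)%g.
  by rewrite W1_Diff_mul invgM mulVKg.
by rewrite eE -W1_Diff_mul W1_Diff_in.
Qed.

Lemma Diff1_group_closed : group_closed (Diff1 R).
Proof.
split=> [|_ _ /Diff1P[a ->] /Diff1P[b ->]].
  by rewrite -W1_Diff0 W1_Diff_in.
have [c ->] := Diff1P (W1_Diff_inv b).
by rewrite -W1_Diff_mul W1_Diff_in.
Qed.

Definition W1_inv a : W1 R := projT1 (cid (Diff1P (W1_Diff_inv a))).

Lemma W1_Diff_invE a : W1_Diff (W1_inv a) = ((W1_Diff a)^-1)%g.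
Proof. by rewrite /W1_inv; case: cid. Qed.

Definition W1_mul a b : W1 R := b + W1_subst a b.

Lemma W1_mulVr a : W1_mul (W1_inv a) a = 0.
Proof. by apply: W1_Diff_inj; rewrite W1_Diff_mul W1_Diff_invE mulVg W1_Diff0. Qed.

Lemma W1_mulrV a : W1_mul a (W1_inv a) = 0.
Proof. by apply: W1_Diff_inj; rewrite W1_Diff_mul W1_Diff_invE mulgV W1_Diff0. Qed.

Lemma W1_inv_mul a b : W1_inv (W1_mul a b) = W1_mul (W1_inv b) (W1_inv a).
Proof.
by apply: W1_Diff_inj; rewrite W1_Diff_invE !W1_Diff_mul !W1_Diff_invE invgM.
Qed.

Lemma shift2_inj : injective (@shift2 R).
Proof.
by move=> u v uv; apply/funext => n; have := congr1 (@^~ n.+2) uv.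
Qed.

Lemma W1_subst_linear b : linear (fun a => W1_subst a b).
Proof.
move=> k a c; apply/val_inj/shift2_inj.
by rewrite shift2_subst !shift2_linear fs_subst_linear -!shift2_subst.
Qed.

Lemma W1_subst0 a : W1_subst a 0 = a.
Proof.
apply/val_inj/shift2_inj; rewrite shift2_subst -W1_seriesE.
by have /(congr1 val) /= -> := W1_Diff0; rewrite fs_substx1.
Qed.

Lemma W1_substA a b c : W1_subst (W1_subst a b) c = W1_subst a (W1_mul b c).
Proof.
apply/val_inj/shift2_inj; rewrite !shift2_subst -!W1_seriesE.
have /(congr1 val) /= -> := W1_Diff_mul b c.
by rewrite fs_substA.
Qed.

(* Right translation by [b] is affine, with linear part [W1_subst^~ b], and
   hence conjugates the translation [b + h] into [W1_subst h (W1_inv b)]. *)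
Lemma W1_mul_translate b h : W1_mul (W1_subst h (W1_inv b)) b = b + h.
Proof. by rewrite /W1_mul W1_substA W1_mulVr W1_subst0. Qed.

(** Here b + h comes from (x + u) o (x + b) with u linear in h, so the only nonlinear operation left
    is the substitution of x + u, which is near the identity for small h. *)
Lemma W1_mul_add a b h : W1_mul a (b + h) =
  b + h + W1_subst (W1_subst a (W1_subst h (W1_inv b))) b.
Proof. by rewrite W1_substA W1_mul_translate. Qed.

(** x + a + h = (x + u) o (x + a). In the inverse, the displacement of (x + u)^-1 is - u o (x +
    u)^-1, so both contributions merge into one substitution whose outer series is affine in h. *)
Lemma W1_inv_add a h : let u := W1_subst h (W1_inv a) in
  W1_inv (a + h) = W1_subst (W1_inv a - u) (W1_inv u).
Proof.
move=> u; rewrite -W1_mul_translate -/u W1_inv_mul /W1_mul.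
have /eqP := W1_mulrV u; rewrite /W1_mul addr_eq0 => /eqP {1}->.
by rewrite [W1_inv a - u]addrC -[- u]scaleN1r W1_subst_linear scaleN1r.
Qed.

End Group.

(** * Power series given by multilinear maps on lists *)

Section LinearFun.
Variables (R : realType) (E F : lmodType R) (L : E -> F).
Hypothesis L_linear : linear L.

Lemma lin_fun0 : L 0 = 0.
Proof. by have := L_linear (-1) 0 0; rewrite scaler0 addr0 scaleN1r addNr. Qed.

Lemma lin_funD x y : L (x + y) = L x + L y.
Proof. by have := L_linear 1 x y; rewrite !scale1r. Qed.

Lemma lin_funN x : L (- x) = - L x.
Proof. by apply/eqP; rewrite -addr_eq0 -lin_funD addNr lin_fun0. Qed.

Lemma lin_funB x y : L (x - y) = L x - L y.
Proof. by rewrite lin_funD lin_funN. Qed.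

Lemma lin_fun_sum I (s : seq I) (u : I -> E) :
  L (\sum_(i <- s) u i) = \sum_(i <- s) L (u i).
Proof.
by elim: s => [|i s IH]; rewrite ?big_nil ?lin_fun0 // !big_cons lin_funD IH.
Qed.

End LinearFun.

Section Families.
Variable R : realType.

(** Lists replace functions on ['I_n]: one map carries the parts of every degree, and arguments can
    be cut into blocks without index arithmetic. *)
Definition seq_multilinear (G F : normedModType R) (M : seq G -> F) :=
  forall s1 s2, linear (fun x : G => M (s1 ++ x :: s2)).

Definition seq_bounded (G F : normedModType R) (M : seq G -> F) (D rho : R) :=
  forall s, `|M s| <= D * rho ^+ size s * \prod_(x <- s) `|x|.

Lemma half_lt1 : `|2^-1 : R| < 1.
Proof. by rewrite ger0_norm // invf_lt1 // ltr1n. Qed.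

(** The radius (2 rho)^-1 turns the operator bounds into a geometric series of ratio 1 / 2. *)
Lemma analytic_at_seq (G F : normedModType R) (M : seq G -> F) (f : G -> F)
    (x : G) (D rho : R) :
  0 < rho -> seq_multilinear M -> seq_bounded M D rho ->
  (forall h, `|h| < (2 * rho)^-1 ->
    series (fun n => M (nseq n h)) @ \oo --> f (x + h)) ->
  analytic_at f x.
Proof.
move=> rho0 Mlin MD Mf.
exists (fun n v => M [seq v i | i <- enum 'I_n]), (fun n => D * rho ^+ n),
  (2 * rho)^-1; split.
- by rewrite invr_gt0 mulr_gt0.
- move=> n; split=> [v i|v].
    (* As [i] occurs once in the enumeration, changing the value at [i] changes a single entry of
       the list. *)
    have /splitPr : i \in enum 'I_n by rewrite mem_enum.
    move Es : (enum 'I_n) => s Hs; case: Hs Es => s1 s2 Es.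
    have := enum_uniq 'I_n; rewrite Es cat_uniq /= negb_or.
    move=> /and3P[_ /andP[is1 _] /andP[is2 _]].
    have E (y : G) : [seq (if j == i then y else v j) | j <- s1 ++ i :: s2] =
        [seq v j | j <- s1] ++ y :: [seq v j | j <- s2].
      rewrite map_cat /= eqxx; congr (_ ++ _ :: _); apply/eq_in_map => j js.
        by case: eqP => // ji; move: is1; rewrite -ji js.
      by case: eqP => // ji; move: is2; rewrite -ji js.
    by move=> k y z; rewrite !E; exact: Mlin.
  have := MD [seq v i | i <- enum 'I_n].
  by rewrite big_map size_map size_enum_ord big_enum.
- rewrite (_ : (fun n => _) = geometric D 2^-1).
    exact/is_cvg_geometric_series/half_lt1.
  apply/funext => n; rewrite /geometric /= -mulrA -exprMn; congr (_ * _ ^+ _).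
  by rewrite invfM mulrCA divff ?mulr1 // gt_eqF.
- move=> h /Mf; suff -> : (fun n => M (nseq n h)) =
      (fun n => M [seq h | _ <- enum 'I_n]) by [].
  apply/funext => n; congr M; rewrite -[n in LHS]size_enum_ord.
  by elim: (enum 'I_n) => //= _ s ->.
Qed.

Lemma bounded_linear_cvg (E F : normedModType R) (L : E -> F) (K : R)
    (u : nat -> E) (l : E) :
  linear L -> (forall x, `|L x| <= K * `|x|) ->
  u @ \oo --> l -> (fun n => L (u n)) @ \oo --> L l.
Proof.
move=> Llin LK ul.
apply/cvgrPdist_lt => e e0.
have K0 : 0 < `|K| + 1 by rewrite ltr_wpDl.
have e'0 : 0 < e / (`|K| + 1) by rewrite divr_gt0.
have /cvgrPdist_lt/(_ _ e'0) := ul; apply: filterS => n.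
rewrite ltr_pdivlMr // mulrC; apply: le_lt_trans.
rewrite -(lin_funB Llin); apply: le_trans (LK _) _.
by rewrite ler_wpM2r // (le_trans (ler_norm _)) // lerDl.
Qed.

End Families.

(** * Inversion of a power series of operators with constant term the identity *)

Section Neumann.
Variables (R : realType) (E : normedModType R) (P : seq E -> E -> E) (K : R).
Hypothesis P_linear : forall s, linear (P s).
Hypothesis P_multilinear : forall a, seq_multilinear (P^~ a).
Hypothesis P_nil : forall a, P [::] a = a.
Hypothesis K0 : 0 <= K.
Hypothesis P_bounded :
  forall s a, `|P s a| <= K ^+ size s * `|a| * \prod_(b <- s) `|b|.

(* [neumann] is the inverse of the formal sum of the [P s]: up to sign, it
   adds up the composites of [P t_1], ..., [P t_m] over all the ways to cut
   its argument into consecutive nonempty blocks [t_1], ..., [t_m].  In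
   [neumann_cut s t], [t] is the block being read. *)
Fixpoint neumann_cut (s t : seq E) (a : E) : E :=
  if s is b :: s' then
    neumann_cut s' (rcons t b) a + neumann_cut s' [:: b] (- P t a)
  else - P t a.

Definition neumann s a := if s is b :: s' then neumann_cut s' [:: b] a else a.

Lemma neumann_cut_linear s t : linear (neumann_cut s t).
Proof.
elim: s t => [|b s IH] t k a c /=; first by rewrite P_linear opprD scalerN.
rewrite IH P_linear opprD -scalerN IH scalerDr !addrA; congr (_ + _).
by rewrite -!addrA; congr (_ + _); rewrite addrC.
Qed.

Lemma neumann_linear s : linear (neumann s).
Proof. by case: s => [|b s] //; exact: neumann_cut_linear. Qed.

Lemma neumann_cut_multilinear_r s t1 t2 a :
  linear (fun x => neumann_cut s (t1 ++ x :: t2) a).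
Proof.
elim: s t1 t2 a => [|b s IH] t1 t2 a k x y /=.
  by rewrite (P_multilinear a t1 t2) opprD scalerN.
rewrite !rcons_cat /= IH (P_multilinear a t1 t2) opprD -scalerN neumann_cut_linear.
rewrite scalerDr -!addrA; congr (_ + _).
by rewrite addrCA.
Qed.

(** Once reached, the varying entry ends the current block or opens a new one, where
    [neumann_cut_multilinear_r] applies. *)
Lemma neumann_cut_multilinear t a : seq_multilinear (fun s => neumann_cut s t a).
Proof.
move=> s1 s2; elim: s1 t a => [|b s1 IH] t a k x y /=.
  rewrite -!cats1 (neumann_cut_multilinear_r s2 t [::]).
  rewrite (neumann_cut_multilinear_r s2 [::] [::]).
  by rewrite scalerDr -!addrA; congr (_ + _); rewrite addrCA.
by rewrite !IH scalerDr -!addrA; congr (_ + _); rewrite addrCA.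
Qed.

Lemma neumann_multilinear a : seq_multilinear (neumann^~ a).
Proof.
move=> [|b s1] s2 /=; first exact: (neumann_cut_multilinear_r s2 [::] [::]).
exact: neumann_cut_multilinear.
Qed.

(** Each entry of [s] either extends the current block or opens a new one, hence a factor 2 per
    entry. *)
Lemma neumann_cut_bounded s t a : `|neumann_cut s t a| <=
  K ^+ size t * (2 * K) ^+ size s * `|a| *
    (\prod_(b <- t) `|b| * \prod_(b <- s) `|b|).
Proof.
elim: s t a => [|b s IH] t a /=; first by rewrite normrN big_nil !mulr1.
apply: le_trans (ler_normD _ _) _.
apply: le_trans (lerD (IH _ _) (IH _ _)) _.
rewrite size_rcons big_rcons !big_cons big_nil mulr1 normrN /=.
set X := \prod_(j <- t) _; set Y := \prod_(j <- s) _; set L := (2 * K) ^+ _.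
have X0 : 0 <= X by rewrite prodr_ge0.
have Y0 : 0 <= Y by rewrite prodr_ge0.
have L0 : 0 <= L by rewrite exprn_ge0 // mulr_ge0.
set B := `|b|.
apply: (@le_trans _ _ (K ^+ (size t).+1 * L * `|a| * (B * X * Y) +
    K * L * (K ^+ size t * `|a| * X) * (B * Y))).
  rewrite [B * X]mulrC lerD // expr1.
  apply: ler_wpM2r; first by rewrite mulr_ge0 ?normr_ge0.
  by apply: ler_wpM2l => //; rewrite mulr_ge0.
by rewrite !exprS -/L le_eqVlt; apply/orP; left; apply/eqP; ring.
Qed.

Lemma neumann_bounded s a :
  `|neumann s a| <= (2 * K) ^+ size s * `|a| * \prod_(b <- s) `|b|.
Proof.
case: s => [|b s]; first by rewrite big_nil mulr1 mul1r.
apply: le_trans (neumann_cut_bounded _ _ _) _; rewrite !big_cons big_nil mulr1 /= expr1.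
rewrite exprS ler_wpM2r ?mulr_ge0 ?prodr_ge0 // ler_wpM2r //.
by rewrite ler_wpM2r ?exprn_ge0 ?mulr_ge0 // ler_peMl // ler1n.
Qed.

(** Grouping by the end of the current block: it takes l more copies of b, and the other n - l are
    cut afresh. *)
Lemma neumann_cut_nseq b n j a : neumann_cut (nseq n b) (nseq j b) a =
  - \sum_(l < n.+1) neumann (nseq (n - l) b) (P (nseq (j + l) b) a).
Proof.
elim: n j => [|n IH] j /=; first by rewrite big_ord1 addn0.
have -> : rcons (nseq j b) b = nseq j.+1 b by elim: j => //= j ->.
rewrite IH [in RHS]big_ord_recl opprD addrC; congr (_ + _).
  rewrite subn0 addn0 /= -[neumann_cut _ _ _]/(neumann (b :: nseq n b) _).
  exact: (lin_funN (neumann_linear _)).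
by congr (- _); apply: eq_bigr => l _; rewrite /bump /= subSS addnS.
Qed.


(** The degree n part of the identity that the Neumann series composed with the sum of the [P] is
    the identity. For n > 0 the term l = 0 is, by [neumann_cut_nseq], the opposite of all the
    others. *)
Lemma sum_neumann b n a : \sum_(l < n.+1)
  neumann (nseq (n - l) b) (P (nseq l b) a) = if n is 0%N then a else 0.
Proof.
rewrite big_ord_recl /= P_nil subn0; case: n => [|n].
  by rewrite big_ord0 addr0.
rewrite [neumann _ _](neumann_cut_nseq b n 1) addrC.
apply/eqP; rewrite subr_eq0; apply/eqP; apply: eq_bigr => l _.
by rewrite /bump /= subSS.
Qed.

Lemma sum_sum_neumann b N a : \sum_(j < N.+1) \sum_(l < N.+1 - j)
  neumann (nseq j b) (P (nseq l b) a) = a.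
Proof.
rewrite -(sum_triangle (fun j l => neumann (nseq j b) (P (nseq l b) a))).
transitivity (\sum_(n < N.+1) if n : nat is 0%N then a else 0).
  apply: eq_bigr => n _; rewrite -(sum_neumann b) (reindex_inj rev_ord_inj) /=.
  by apply: eq_bigr => l _; rewrite subSS subKn // -ltnS.
by rewrite big_ord_recl big1 ?addr0.
Qed.

Lemma sum_pow2_le N : \sum_(j < N) (2 : R) ^+ j <= 2 ^+ N.
Proof.
elim: N => [|N IH]; first by rewrite big_ord0 expr0 ler01.
by rewrite big_ord_recr /= exprS mulrDl mul1r lerD2r.
Qed.

(* The double sum over [j + l <= N] equals [a], and differs from the partial sum
   at [c] by [\sum_j O((2 y)^j y^(N - j))]. *)
Lemma neumann_cvg a b c : K * `|b| < 4^-1 ->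
  series (fun n => P (nseq n b) a) @ \oo --> c ->
  series (fun n => neumann (nseq n b) c) @ \oo --> a.
Proof.
set y := K * `|b| => y4; pose S := series (fun n => P (nseq n b) a).
rewrite -/S => Sc; have y0 : 0 <= y by exact: mulr_ge0.
have prod_nseq n : \prod_(x <- nseq n b) `|x| = `|b| ^+ n.
  by rewrite big_nseq; elim: n => // n IH; rewrite exprS -IH.
have Pb n : `|P (nseq n b) a| <= `|a| * y ^+ n.
  apply: le_trans (P_bounded _ _) _; rewrite size_nseq prod_nseq exprMn.
  by rewrite mulrAC mulrC.
(* The telescoping bound passes the induction because y <= 1 / 2 gives y^n <= 2 (y^n - y^(n +
   1)). *)
have tail m k : `|S (m + k)%N - S m| <= 2 * `|a| * (y ^+ m - y ^+ (m + k)).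
  elim: k => [|k IH]; first by rewrite addn0 !subrr normr0 mulr0.
  rewrite addnS /S seriesSr -/S addrAC.
  apply: le_trans (ler_normD _ _) _; apply: le_trans (lerD IH (Pb _)) _.
  rewrite exprS; have := exprn_ge0 (m + k) y0; have := normr_ge0 a.
  set A := `|a|; set Y := y ^+ (m + k) => A0 Y0.
  have : 0 <= A * Y * (1 - 2 * y) by rewrite !mulr_ge0 //; lra.
  by move: (y ^+ m) => Z H; rewrite -subr_ge0; apply: le_trans H _; lra.
have Sc_le m : `|c - S m| <= 2 * `|a| * y ^+ m.
  apply: (@cvgr_to_le _ \oo _ R (fun k => `|S (m + k)%N - S m|)).
    apply: cvg_norm; apply: cvgB; last exact: cvg_cst.
    rewrite (_ : (fun k => S (m + k)%N) = [sequence S (k + m)%N]_k).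
      by rewrite cvg_shiftn.
    by apply/funext => k; rewrite addnC.
  apply: nearW => k; apply: le_trans (tail m k) _.
  by rewrite ler_wpM2l ?mulr_ge0 // gerBl exprn_ge0.
have nb n x : `|neumann (nseq n b) x| <= (2 * y) ^+ n * `|x|.
  apply: le_trans (neumann_bounded _ _) _.
  by rewrite size_nseq prod_nseq /y mulrA [in leRHS]exprMn mulrAC.
have rem N : `|series (fun n => neumann (nseq n b) c) N.+1 - a| <=
    2 * `|a| * (2 * y) ^+ N.+1.
  rewrite -[a in leLHS](sum_sum_neumann b N) /series /= big_mkord -sumrB.
  apply: le_trans (ler_norm_sum _ _ _) _.
  apply: le_trans (_ : \sum_(j < N.+1) 2 * `|a| * y ^+ N.+1 * 2 ^+ j <= _).
    apply: ler_sum => j _.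
    have -> : \sum_(l < N.+1 - j) neumann (nseq j b) (P (nseq l b) a) =
        neumann (nseq j b) (S (N.+1 - j)%N).
      rewrite /S /series /= big_mkord.
      by rewrite (lin_fun_sum (neumann_linear (nseq j b))).
    rewrite -(lin_funB (neumann_linear (nseq j b))).
    apply: le_trans (nb _ _) _.
    apply: le_trans (ler_wpM2l _ (Sc_le _)) _.
      by rewrite exprn_ge0 // mulr_ge0.
    have -> : y ^+ N.+1 = y ^+ j * y ^+ (N.+1 - j).
      by rewrite -exprD subnKC // ltnW.
    by rewrite exprMn le_eqVlt; apply/orP; left; apply/eqP; ring.
  rewrite -mulr_sumr [(2 * y) ^+ _]exprMn [X in _ <= _ * X]mulrC mulrA.
  by rewrite ler_wpM2l ?sum_pow2_le // !mulr_ge0 ?exprn_ge0.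
have y2 : `|2 * y| < 1 by rewrite ger0_norm ?mulr_ge0 //; lra.
rewrite -cvg_shiftS /=; apply/cvgrPdist_le => e e0.
have /cvgrPdist_le/(_ e e0) := cvg_geometric (2 * `|a| * (2 * y)) y2.
apply: filterS => N; rewrite sub0r normrN distrC => H; apply: le_trans (rem N) _.
by apply: le_trans H; rewrite exprS mulrA; exact: ler_norm.
Qed.

End Neumann.

(** * Analyticity of substitution with affinely varying arguments *)

Section AnalyticBilinear.
Variables (R : realType) (G E F : normedModType R).
Variables (P : seq E -> E -> E) (K : R).
Hypothesis P_linear : forall s, linear (P s).
Hypothesis P_multilinear : forall a, seq_multilinear (P^~ a).
Hypothesis K0 : 0 <= K.
Hypothesis P_bounded :
  forall s a, `|P s a| <= K ^+ size s * `|a| * \prod_(b <- s) `|b|.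
Variables (V : E -> E -> E) (rho : R).
Hypothesis rho0 : 0 < rho.
Hypothesis P_cvg : forall a b, `|b| < rho ->
  series (fun n => P (nseq n b) a) @ \oo --> V a b.

(* The slot of [a] also varies with [h], so the homogeneous part of degree n
   involves [P] at lists of lengths n and n - 1. *)
Lemma analytic_at_subst (A B : G -> E) (Phi : E -> F) (Psi : G -> F)
    (alpha beta phi psi : R) (y0 : F) (a0 : E) (f : G -> F) (x : G) :
  linear A -> linear B -> linear Phi -> linear Psi ->
  (forall h, `|A h| <= alpha * `|h|) -> (forall h, `|B h| <= beta * `|h|) ->
  (forall a, `|Phi a| <= phi * `|a|) -> (forall h, `|Psi h| <= psi * `|h|) ->
  0 <= alpha -> 0 <= beta -> 0 <= phi -> 0 <= psi ->
  (forall h, f (x + h) = y0 + Psi h + Phi (V (a0 + A h) (B h))) ->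
  analytic_at f x.
Proof.
move=> Alin Blin Philin Psilin AB BB PhiB PsiB alpha0 beta0 phi0 psi0 fE.
(* [base] collects the affine part, [fixed] keeps a0 in the slot, and [moving] spends the first
   entry of the list on the slot. *)
pose base (s : seq G) : F :=
  match s with [::] => y0 | [:: h] => Psi h | _ => 0 end.
pose fixed (s : seq G) := Phi (P (map B s) a0).
pose moving (s : seq G) : F :=
  if s is h :: s' then Phi (P (map B s') (A h)) else 0.
pose M s := base s + fixed s + moving s.
(* K beta is the growth rate of the terms, beta / rho keeps |B h| < rho on the disc of radius (2
   r)^-1, and r >= 1 lets [D] cover the low degrees. *)
pose r := 1 + K * beta + beta / rho.
have Kb0 : 0 <= K * beta by rewrite mulr_ge0.
have br0 : 0 <= beta / rho by rewrite divr_ge0 // ltW.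
have r1 : 1 <= r by rewrite /r -addrA lerDl addr_ge0.
have r0 : 0 < r by exact: lt_le_trans r1.
pose D := `|y0| + psi + phi * `|a0| + phi * alpha.
have prodB s : \prod_(b <- map B s) `|b| <= beta ^+ size s * \prod_(h <- s) `|h|.
  rewrite big_map; elim: s => [|h s IH]; first by rewrite !big_nil mulr1.
  rewrite !big_cons exprS mulrACA ler_pM ?prodr_ge0 //.
have PB s a : `|Phi (P (map B s) a)| <=
    phi * `|a| * r ^+ size s * \prod_(h <- s) `|h|.
  apply: le_trans (PhiB _) _.
  rewrite -!mulrA ler_wpM2l //; apply: le_trans (P_bounded _ _) _.
  rewrite size_map [K ^+ _ * _]mulrC -!mulrA ler_wpM2l //.
  apply: le_trans (_ : K ^+ size s * (beta ^+ size s * \prod_(h <- s) `|h|) <= _).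
    by rewrite ler_wpM2l ?exprn_ge0.
  rewrite mulrA -exprMn ler_wpM2r ?prodr_ge0 // lerXn2r ?nnegrE // /r; lra.
apply: (@analytic_at_seq _ _ _ M f x D r) => //.
- move=> s1 s2 k u v; rewrite /M.
  have -> : base (s1 ++ (k *: u + v) :: s2) =
      k *: base (s1 ++ u :: s2) + base (s1 ++ v :: s2).
    case: s1 => [|? [|? ?]] /=; [|by rewrite scaler0 addr0..].
    by case: s2 => [|? ?]; rewrite ?Psilin // scaler0 addr0.
  have -> : fixed (s1 ++ (k *: u + v) :: s2) =
      k *: fixed (s1 ++ u :: s2) + fixed (s1 ++ v :: s2).
    by rewrite /fixed !map_cat /= Blin P_multilinear Philin.
  have -> : moving (s1 ++ (k *: u + v) :: s2) =
      k *: moving (s1 ++ u :: s2) + moving (s1 ++ v :: s2).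
    case: s1 => [|h s1] /=; first by rewrite Alin P_linear Philin.
    by rewrite !map_cat /= Blin P_multilinear Philin.
  by rewrite !scalerDr [RHS]addrACA [X in _ = X + _]addrACA.
- move=> s; rewrite /M; apply: le_trans (ler_normD _ _) _.
  have Pi0 (t : seq G) : 0 <= \prod_(h <- t) `|h| by rewrite prodr_ge0.
  have rn n : 1 <= r ^+ n by rewrite exprn_ege1.
  apply: (@le_trans _ _ ((`|y0| + psi) * (r ^+ size s * \prod_(h <- s) `|h|) +
     phi * `|a0| * r ^+ size s * \prod_(h <- s) `|h| +
     phi * alpha * (r ^+ size s * \prod_(h <- s) `|h|))); last first.
    by rewrite /D le_eqVlt; apply/orP; left; apply/eqP; ring.
  apply: lerD; first (apply: le_trans (ler_normD _ _) _; apply: lerD).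
  + case: s => [|h [|h' s]] /=.
    * by rewrite big_nil !mulr1 lerDl.
    * rewrite big_cons big_nil mulr1 expr1 mulrDl.
      apply: le_trans (PsiB h) _; rewrite -[leLHS]add0r lerD ?mulr_ge0 ?(ltW r0) //.
      by rewrite ler_wpM2l // ler_peMl.
    * rewrite normr0 mulr_ge0 ?addr_ge0 // mulr_ge0 ?Pi0 //.
      by rewrite exprn_ge0 // ltW.
  + exact: PB.
  + case: s => [|h s] /=; first by rewrite normr0 big_nil !mulr1 mulr_ge0.
    apply: le_trans (PB _ _) _; rewrite big_cons.
    set Q := \prod_(_ <- _) _; have Q0 : 0 <= Q by exact: Pi0.
    rewrite -!mulrA ler_wpM2l // exprS.
    apply: le_trans (_ : alpha * `|h| * (r ^+ size s * Q) <= _).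
      by rewrite ler_wpM2r // mulr_ge0 ?exprn_ge0 ?(ltW r0).
    rewrite -!mulrA ler_wpM2l // mulrCA.
    rewrite ler_peMl // mulr_ge0 ?exprn_ge0 ?(ltW r0) //.
    by rewrite mulr_ge0.
- move=> h hr.
  have Bh : `|B h| < rho.
    apply: le_lt_trans (BB h) _.
    have : beta / rho <= r by rewrite /r lerDr addr_ge0.
    rewrite ler_pdivrMr // => bn.
    apply: (@le_lt_trans _ _ (r * rho * `|h|)); first by rewrite ler_wpM2r.
    move: hr; rewrite invfM ltr_pdivlMr // => hr.
    rewrite mulrC mulrA -[ltRHS]mul1r ltr_pM2r //.
    by apply: lt_trans hr _; rewrite invf_lt1 // ltr1n.
  have [a0c Ac] := (@P_cvg a0 _ Bh, @P_cvg (A h) _ Bh).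
  (* [V] inherits additivity in the slot from [P], by uniqueness of limits. *)
  have VD : V (a0 + A h) (B h) = V a0 (B h) + V (A h) (B h).
    apply: (cvg_unique _ (@P_cvg (a0 + A h) _ Bh)) => //.
    rewrite (_ : series _ = series (fun n => P (nseq n (B h)) a0) +
        series (fun n => P (nseq n (B h)) (A h))); first exact: cvgD a0c Ac.
    rewrite -seriesD; congr series; apply/funext => n.
    exact: (lin_funD (P_linear _)).
  rewrite fE VD (lin_funD Philin) addrA.
  (* From the second partial sum on, [base] contributes exactly y0 + Psi h, while [moving] lags one
     degree behind. *)
  rewrite -cvg_shiftS /= -cvg_shiftS /=.
  have -> : (fun n => series (fun n => M (nseq n h)) n.+2) = fun n =>
      y0 + Psi h + Phi (series (fun n => P (nseq n (B h)) a0) n.+2) +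
      Phi (series (fun n => P (nseq n (B h)) (A h)) n.+1).
    apply/funext => n; rewrite /series /= !(lin_fun_sum Philin) /M.
    rewrite !big_split /= /fixed /moving.
    rewrite [in X in _ + X]big_nat_recl //= add0r; congr (_ + _ + _).
    - rewrite !big_nat_recl //= big1 ?addr0 //.
    - by apply: eq_bigr => i _; rewrite map_nseq.
    - by apply: eq_bigr => i _; rewrite map_nseq.
  apply: cvgD; first apply: cvgD; first exact: cvg_cst.
  - apply: (bounded_linear_cvg Philin PhiB).
    by rewrite (cvg_shiftS (fun n => series _ n.+1)) cvg_shiftS.
  - by apply: (bounded_linear_cvg Philin PhiB); rewrite cvg_shiftS.
Qed.
End AnalyticBilinear.

(** * Analyticity of the group operations *)

Section Analyticity.
Variable R : realType.
Implicit Types (a b c h : W1 R).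

Lemma W1_taylor_nil a : W1_taylor [::] a = a.
Proof.
apply/val_inj/funext => n; rewrite /= /W1_taylor_seq /taylor_term big_nil mulr1.
by rewrite coef_poly ltnSn /taylor_coef add0n bin0.
Qed.

Lemma W1_taylor_bounded (s : seq (W1 R)) a :
  `|W1_taylor s a| <= 2 ^+ size s * `|a| * \prod_(b <- s) `|b|.
Proof.
apply: le_trans (W1_taylor_le s a) _.
rewrite ler_wpM2r ?prodr_ge0 // ler_wpM2r // ler_pdivrMr ?factr_gt0 //.
by rewrite ler_peMr ?exprn_ge0 // ler1n fact_gt0.
Qed.

Lemma W1_subst_bound b : exists2 K : R, 0 <= K &
  forall a, `|W1_subst a b| <= K * `|a|.
Proof.
by exists (expR (2 * `|b|)) => [|a]; rewrite ?expR_ge0 // mulrC W1_subst_le.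
Qed.

Lemma snd_bound (h : W1 R * W1 R) : `|h.2| <= 1 * `|h|.
Proof. by rewrite mul1r prod_normE le_max lexx orbT. Qed.

(** By [W1_mul_add], this is [analytic_at_subst] for the Taylor family. That series converges for
    every b, so the radius 1 is an arbitrary choice. *)
Lemma W1_mul_analytic : analytic (fun p : W1 R * W1 R => W1_mul p.1 p.2).
Proof.
move=> [a0 b0].
have [K K0 KP] := W1_subst_bound b0.
have [L L0 LP] := W1_subst_bound (W1_inv b0).
apply: (@analytic_at_subst R (W1 R * W1 R)%type (W1 R) (W1 R) (@W1_taylor R) 2
  _ _ _ _ (@W1_subst R) 1 _ _ (fun h : W1 R * W1 R => h.1)
  (fun h : W1 R * W1 R => W1_subst h.2 (W1_inv b0)) (fun a => W1_subst a b0)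
  (fun h : W1 R * W1 R => h.2) 1 L K 1 b0 a0) => //.
- exact: W1_taylor_linear.
- by move=> a s1 s2; exact: W1_taylor_multilinear.
- exact: W1_taylor_bounded.
- by move=> a b _; exact: W1_subst_cvg.
- by move=> k u v; exact: W1_subst_linear.
- exact: W1_subst_linear.
- by move=> h; rewrite mul1r prod_normE le_max lexx.
- move=> h; apply: le_trans (LP _) _; rewrite ler_wpM2l //.
  by have := snd_bound h; rewrite mul1r.
- exact: snd_bound.
- by move=> h /=; rewrite W1_mul_add.
Qed.

(** Substituting x + b into a o (x + b)^-1 gives back a. The radius 1 / 8 comes from K |b| < 1 / 4
    with K = 2. *)
Lemma W1_neumann_cvg a b : `|b| < 8^-1 ->
  series (fun n => neumann (@W1_taylor R) (nseq n b) a) @ \oo -->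
    W1_subst a (W1_inv b).
Proof.
move=> b8; apply: (@neumann_cvg _ _ _ 2) => //.
- exact: W1_taylor_linear.
- exact: W1_taylor_nil.
- exact: W1_taylor_bounded.
- lra.
- have := @W1_subst_cvg R (W1_subst a (W1_inv b)) b.
  by rewrite W1_substA W1_mulVr W1_subst0.
Qed.

(** By [W1_inv_add], this is [analytic_at_subst] for the Neumann family of the Taylor terms, whose
    bound is doubled from 2 to 2 * 2. *)
Lemma W1_inv_analytic : analytic (@W1_inv R).
Proof.
move=> a0.
have [L L0 LP] := W1_subst_bound (W1_inv a0).
apply: (@analytic_at_subst R _ _ _ (neumann (@W1_taylor R)) (2 * 2) _ _ _ _
  (fun a b => W1_subst a (W1_inv b)) 8^-1 _ _
  (fun h => - W1_subst h (W1_inv a0)) (fun h => W1_subst h (W1_inv a0)) id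
  (fun=> 0) L L 1 0 0 (W1_inv a0)) => //.
- by apply: neumann_linear; exact: W1_taylor_linear.
- apply: neumann_multilinear; first exact: W1_taylor_linear.
  by move=> a s1 s2; exact: W1_taylor_multilinear.
- apply: neumann_bounded => //; exact: W1_taylor_bounded.
- exact: W1_neumann_cvg.
- by move=> k u v; rewrite W1_subst_linear opprD scalerN.
- exact: W1_subst_linear.
- by move=> k u v; rewrite scaler0 addr0.
- by move=> h; rewrite normrN.
- by move=> a; rewrite mul1r.
- by move=> h; rewrite normr0 mul0r.
- by move=> h; rewrite !add0r; exact: W1_inv_add.
Qed.

End Analyticity.

Theorem theorem1p1 (R : realType) :
  group_closed (Diff1 R) /\
  (exists2 m : W1 R * W1 R -> W1 R,
     (forall a b : W1 R, W1_Diff (m (a, b)) = (W1_Diff a * W1_Diff b)%g) &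
     analytic m) /\
  (exists2 i : W1 R -> W1 R,
     (forall a : W1 R, W1_Diff (i a) = ((W1_Diff a)^-1)%g) &
     analytic i).
Proof.
split; first exact: Diff1_group_closed.
split.
  by exists (fun p => W1_mul p.1 p.2); [exact: W1_Diff_mul|exact: W1_mul_analytic].
by exists (@W1_inv R); [exact: W1_Diff_invE|exact: W1_inv_analytic].
Qed.
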